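(* Let $(\Sigma,\partial)$ be a differential field whose field of constants $\mathbf{C}$ is algebraically closed and of characteristic zero. Let $P,Q\in\Sigma[\partial]\setminus\mathbf{C}[\partial]$ both have positive order. If $P$ and $Q$ commute, then $\mathbf{C}[P,Q]$ is a domain isomorphic to $\mathbf{C}[\lambda,\mu]/\mathrm{BC}(P,Q)$, the coordinate ring of the spectral curve $\Gamma_{P,Q}$.
   Context: $\Sigma[\partial]$ is the ring of differential operators with coefficients in $\Sigma$ ($\partial a=a\partial+\partial(a)$). For commuting $P,Q$, $\mathbf{C}[P,Q]=\{\sum_{i,j}\sigma_{i,j}P^iQ^j\mid\sigma_{i,j}\in\mathbf{C}\}$ (finite sums) is the $\mathbf{C}$-algebra generated by $P,Q$ in $\Sigma[\partial]$. The Burchnall–Chaundy ideal is $\mathrm{BC}(P,Q)=\{g\in\mathbf{C}[\lambda,\mu]\mid g(P,Q)=0\}$, the kernel of the ring homomorphism $\mathbf{C}[\lambda,\mu]\to\Sigma[\partial]$, $\lambda\mapsto P$, $\mu\mapsto Q$. The spectral curve of the pair is the algebraic variety $\Gamma_{P,Q}=V(\mathrm{BC}(P,Q))=\{(\lambda_0,\mu_0)\in\mathbf{C}^2\mid g(\lambda_0,\mu_0)=0\text{ for all }g\in\mathrm{BC}(P,Q)\}$. *)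

(* Defs.v *)
From HB Require Import structures.
From mathcomp Require Import all_boot all_order all_algebra.
From mathcomp Require Import boolp mpoly.

Set Implicit Arguments.
Unset Strict Implicit.
Unset Printing Implicit Defensive.

Import GRing.Theory.
Local Open Scope ring_scope.
Local Open Scope quotient_scope.

HB.mixin Record isDifferentialField K of GRing.Field K := {
  der : K -> K;
  derD : forall a b : K, der (a + b) = der a + der b;
  derM : forall a b : K, der (a * b) = der a * b + a * der b
}.

#[short(type="diffFieldType")]
HB.structure Definition DifferentialField :=
  { K of GRing.Field K & isDifferentialField K }.

Section Derivation.
Variable K : diffFieldType.
Implicit Types a b : K.

Lemma der0 : der (0 : K) = 0.
Proof. by apply: (addrI (der (0 : K))); rewrite -derD !addr0. Qed.

Lemma derN a : der (- a) = - der a.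
Proof. by apply/eqP; rewrite -addr_eq0 -derD addNr der0. Qed.

Lemma derB a b : der (a - b) = der a - der b.
Proof. by rewrite derD derN. Qed.

Lemma der1 : der (1 : K) = 0.
Proof.
by apply: (addrI (der (1 : K))); rewrite addr0 -{3}[1]mulr1 derM mulr1 mul1r.
Qed.

HB.instance Definition _ := GRing.isZmodMorphism.Build K K (@der K) derB.

Definition is_constant : {pred K} := [pred a | der a == 0].

Lemma is_constant_divring_closed : divring_closed is_constant.
Proof.
split=> [|a b|a b]; rewrite !inE ?der1 //.
  by move=> /eqP a0 /eqP b0; rewrite derB a0 b0 subrr.
move=> /eqP a0 /eqP b0; rewrite derM a0 mul0r add0r.
have [->|b_neq0] := eqVneq b 0; first by rewrite invr0 der0 mulr0.
have : der (b * b^-1) = 0 by rewrite divff // der1.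
rewrite derM b0 mul0r add0r => /eqP; rewrite mulf_eq0 (negPf b_neq0) /= => /eqP->.
by rewrite mulr0.
Qed.
HB.instance Definition _ :=
  GRing.isDivringClosed.Build K is_constant is_constant_divring_closed.

End Derivation.

Definition constants (K : diffFieldType) := {a : K | a \in @is_constant K}.

HB.instance Definition _ (K : diffFieldType) := SubChoice.on (constants K).
HB.instance Definition _ (K : diffFieldType) :=
  [SubChoice_isSubIntegralDomain of constants K by <:].
HB.instance Definition _ (K : diffFieldType) :=
  [SubIntegralDomain_isSubField of constants K by <:].

(* [DiffOp p] is the operator \sum_i p`_i \partial^i; the wrapper keeps its   *)
(* product apart from the commutative product of {poly K}.                    *)
Record diffop (K : diffFieldType) := DiffOp { coefs : {poly K} }.
Add Printing Constructor diffop.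

HB.instance Definition _ (K : diffFieldType) := [isNew for @coefs K].
HB.instance Definition _ (K : diffFieldType) := [Choice of diffop K by <:].

Section DiffOpRing.
Variable K : diffFieldType.
Notation C := (constants K).
Implicit Types (p q r : {poly K}) (P Q R : diffop K) (a : K) (c : C).

Lemma coefs_inj : injective (@coefs K).
Proof. exact: val_inj. Qed.

Definition dop_add P Q := DiffOp (coefs P + coefs Q).
Definition dop_opp P := DiffOp (- coefs P).

Lemma dop_addA : associative dop_add.
Proof. by move=> P Q R; apply: coefs_inj; rewrite /= addrA. Qed.
Lemma dop_addC : commutative dop_add.
Proof. by move=> P Q; apply: coefs_inj; rewrite /= addrC. Qed.
Lemma dop_add0 : left_id (DiffOp 0) dop_add.
Proof. by move=> P; apply: coefs_inj; rewrite /= add0r. Qed.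
Lemma dop_addN : left_inverse (DiffOp 0) dop_opp dop_add.
Proof. by move=> P; apply: coefs_inj; rewrite /= addNr. Qed.

HB.instance Definition _ :=
  GRing.isZmodule.Build (diffop K) dop_addA dop_addC dop_add0 dop_addN.

(* Left multiplication by \partial:                                           *)
(*   \partial (b \partial^j) = b \partial^(j+1) + \partial(b) \partial^j.     *)
Definition dshift q : {poly K} := q * 'X + map_poly der q.

Definition dmul p q : {poly K} := \sum_(i < size p) p`_i *: iter i dshift q.

Lemma dshiftD : {morph dshift : p q / p + q}.
Proof. by move=> p q; rewrite /dshift mulrDl raddfD addrACA. Qed.

Lemma dshiftZ a q : dshift (a *: q) = a *: dshift q + der a *: q.
Proof.
rewrite /dshift -scalerAl scalerDr -addrA; congr (_ + _).
by apply/polyP=> i; rewrite !(coefD, coefZ, coef_map) /= derM addrC.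
Qed.

Lemma dshift0 : dshift 0 = 0.
Proof. by rewrite /dshift mul0r raddf0 addr0. Qed.

Lemma dshift_sum I (s : seq I) (F : I -> {poly K}) :
  dshift (\sum_(i <- s) F i) = \sum_(i <- s) dshift (F i).
Proof. exact: (big_morph _ dshiftD dshift0). Qed.

Lemma iter_dshiftD n : {morph iter n dshift : p q / p + q}.
Proof. by elim: n => [//|n IHn] p q /=; rewrite IHn dshiftD. Qed.

Lemma dmulE n p q : (size p <= n)%N ->
  dmul p q = \sum_(i < n) p`_i *: iter i dshift q.
Proof.
move=> le_p_n; rewrite /dmul (big_ord_widen n (fun i => p`_i *: iter i dshift q)) //.
rewrite big_mkcond; apply: eq_bigr => i _; case: ltnP => // le_p_i.
by rewrite nth_default ?scale0r.
Qed.

Lemma dmulDl : left_distributive dmul +%R.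
Proof.
move=> p q r; have le_pq := size_polyD p q; set n := maxn _ _ in le_pq.
rewrite (dmulE r le_pq) (dmulE r (leq_maxl _ _ : size p <= n)%N).
rewrite (dmulE r (leq_maxr _ _ : size q <= n)%N) -big_split /=.
by apply: eq_bigr => i _; rewrite coefD scalerDl.
Qed.

Lemma dmulDr : right_distributive dmul +%R.
Proof.
move=> p q r; rewrite /dmul -big_split /=; apply: eq_bigr => i _.
by rewrite iter_dshiftD scalerDr.
Qed.

Lemma dmulZl a p q : dmul (a *: p) q = a *: dmul p q.
Proof.
rewrite (dmulE q (size_scale_leq a p)) scaler_sumr.
by apply: eq_bigr => i _; rewrite coefZ scalerA.
Qed.

Lemma dmul0l q : dmul 0 q = 0.
Proof. by rewrite /dmul size_poly0 big_ord0. Qed.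

Lemma dmul_suml I (s : seq I) (F : I -> {poly K}) q :
  dmul (\sum_(i <- s) F i) q = \sum_(i <- s) dmul (F i) q.
Proof.
by apply: (big_morph (dmul^~ q)) => [p r|]; rewrite ?dmulDl ?dmul0l.
Qed.

Lemma dmulXn i q : dmul 'X^i q = iter i dshift q.
Proof.
rewrite /dmul size_polyXn big_ord_recr /= coefXn eqxx scale1r big1 ?add0r //.
by move=> j _; rewrite coefXn ltn_eqF // scale0r.
Qed.

Lemma dmulC a q : dmul a%:P q = a *: q.
Proof. by rewrite -[a%:P]mulr1 mul_polyC dmulZl -[1]/('X^0) dmulXn. Qed.

Lemma dmul1l : left_id 1 dmul.
Proof. by move=> q; rewrite -[1]/('X^0) dmulXn. Qed.

Lemma dshiftX i : dshift 'X^i = 'X^(i.+1).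
Proof.
rewrite /dshift -exprSr [X in _ + X](_ : _ = 0) ?addr0 //.
by apply/polyP=> j; rewrite coef_map coefXn coef0; case: eqP => _ /=;
  rewrite ?der1 ?der0.
Qed.

Lemma dmul1r : right_id 1 dmul.
Proof.
have iter1 i : iter i dshift 1 = 'X^i by elim: i => //= i ->; rewrite dshiftX.
move=> p; rewrite -[RHS]coefK poly_def /dmul.
by apply: eq_bigr => i _; rewrite iter1.
Qed.

Lemma dshift_mul q r : dshift (dmul q r) = dmul (dshift q) r.
Proof.
rewrite [dmul q r]/dmul dshift_sum -[in RHS](coefK q) poly_def dshift_sum dmul_suml.
apply: eq_bigr => i _.
by rewrite !dshiftZ dmulDl !dmulZl dshiftX !dmulXn.
Qed.

Lemma dmulA : associative dmul.
Proof.
move=> p q r; rewrite {1}/dmul [dmul p q]/dmul dmul_suml; apply: eq_bigr => i _.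
rewrite dmulZl; congr (_ *: _).
by elim: (i : nat) => //= j ->; rewrite dshift_mul.
Qed.

Definition dop_one := DiffOp (1 : {poly K}).
Definition dop_mul P Q := DiffOp (dmul (coefs P) (coefs Q)).

Lemma dop_mulA : associative dop_mul.
Proof. by move=> P Q R; apply: coefs_inj; rewrite /= dmulA. Qed.
Lemma dop_mul1l : left_id dop_one dop_mul.
Proof. by move=> P; apply: coefs_inj; rewrite /= dmul1l. Qed.
Lemma dop_mul1r : right_id dop_one dop_mul.
Proof. by move=> P; apply: coefs_inj; rewrite /= dmul1r. Qed.
Lemma dop_mulDl : left_distributive dop_mul +%R.
Proof. by move=> P Q R; apply: coefs_inj; rewrite /= dmulDl. Qed.
Lemma dop_mulDr : right_distributive dop_mul +%R.
Proof. by move=> P Q R; apply: coefs_inj; rewrite /= dmulDr. Qed.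
Lemma dop_oner_neq0 : dop_one != 0.
Proof. by apply/eqP=> /(congr1 (@coefs K))/eqP; rewrite oner_eq0. Qed.

HB.instance Definition _ := GRing.Zmodule_isNzRing.Build (diffop K)
  dop_mulA dop_mul1l dop_mul1r dop_mulDl dop_mulDr dop_oner_neq0.

Definition dop_scale c P : diffop K := DiffOp (val c *: coefs P).

Lemma dop_scaleA c d P : dop_scale c (dop_scale d P) = dop_scale (c * d) P.
Proof. by apply: coefs_inj; rewrite /= scalerA. Qed.
Lemma dop_scale1 : left_id 1 dop_scale.
Proof. by move=> P; apply: coefs_inj; rewrite /= scale1r. Qed.
Lemma dop_scaleDr : right_distributive dop_scale +%R.
Proof. by move=> c P Q; apply: coefs_inj; rewrite /= scalerDr. Qed.
Lemma dop_scaleDl P : {morph dop_scale^~ P : c d / c + d}.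
Proof. by move=> c d; apply: coefs_inj; rewrite /= scalerDl. Qed.

HB.instance Definition _ := GRing.Zmodule_isLmodule.Build C (diffop K)
  dop_scaleA dop_scale1 dop_scaleDr dop_scaleDl.

Lemma dop_scaleAl c P Q : c *: (P * Q) = c *: P * Q.
Proof. by apply: coefs_inj; rewrite /= dmulZl. Qed.

HB.instance Definition _ :=
  GRing.Lmodule_isLalgebra.Build C (diffop K) dop_scaleAl.

Lemma iter_dshift_scale c i q :
  iter i dshift (val c *: q) = val c *: iter i dshift q.
Proof.
elim: i => //= i ->; rewrite dshiftZ.
by have /eqP-> := valP c; rewrite scale0r addr0.
Qed.

Lemma dop_scaleAr c P Q : c *: (P * Q) = P * (c *: Q).
Proof.
apply: coefs_inj; rewrite /= /dmul scaler_sumr; apply: eq_bigr => i _.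
by rewrite iter_dshift_scale !scalerA mulrC.
Qed.

HB.instance Definition _ :=
  GRing.Lalgebra_isAlgebra.Build C (diffop K) dop_scaleAr.

Definition dop_coef a : diffop K := DiffOp a%:P.
Definition dop_der : diffop K := DiffOp 'X.

Lemma dop_derM a : dop_der * dop_coef a = dop_coef a * dop_der + dop_coef (der a).
Proof.
apply: coefs_inj; rewrite /= dmulC -['X]expr1 dmulXn /= expr1 /dshift mul_polyC.
by congr (_ + _); rewrite map_polyC.
Qed.

Lemma dopE P : P = \sum_(i < size (coefs P)) dop_coef (coefs P)`_i * dop_der ^+ i.
Proof.
have coefs_sum I (s : seq I) (F : I -> diffop K) :
    coefs (\sum_(i <- s) F i) = \sum_(i <- s) coefs (F i).
  exact: (big_morph (@coefs K) (fun _ _ => erefl) erefl).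
have coefsX i : coefs (dop_der ^+ i) = 'X^i.
  elim: i => // i IHi; rewrite exprS /= IHi -['X]expr1 dmulXn /=.
  by rewrite dshiftX.
apply: coefs_inj; rewrite coefs_sum -{1}[coefs P]coefK poly_def.
by apply: eq_bigr => i _; rewrite /= coefsX dmulC.
Qed.

Definition dop_order P : nat := (size (coefs P)).-1.

Definition const_coefs : {pred diffop K} :=
  [pred P | coefs P \is a polyOver (@is_constant K)].

End DiffOpRing.

(* {mpoly C[2]} is C[\lambda, \mu], with \lambda = 'X_0 and \mu = 'X_1.       *)
Section CommutingPair.
Variable K : diffFieldType.
Notation C := (constants K).
Notation dop := (diffop K).
Implicit Types (P Q : dop) (g : {mpoly C[2]}).

Definition dop_eval P Q g : dop :=
  \sum_(m <- msupp g) g@_m *: (P ^+ m ord0 * Q ^+ m ord_max).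

Lemma dop_eval_mmap P Q g :
  dop_eval P Q g = mmap (GRing.in_alg dop) (tnth [tuple P; Q]) g.
Proof.
apply: eq_bigr => m _; rewrite mulr_algl /mmap1 big_ord_recl big_ord1.
by rewrite !(tnth_nth 0) (_ : lift _ _ = ord_max) //; apply: val_inj.
Qed.

Lemma dop_eval_is_linear P Q : linear (dop_eval P Q).
Proof.
move=> c g h; rewrite !dop_eval_mmap raddfD /= mmapZ.
by rewrite [GRing.in_alg _ _ * _]mulr_algl.
Qed.
HB.instance Definition _ P Q :=
  GRing.isLinear.Build C {mpoly C[2]} dop *:%R (dop_eval P Q)
    (dop_eval_is_linear P Q).

Lemma dop_evalXm P Q m : dop_eval P Q 'X_[m] = P ^+ m ord0 * Q ^+ m ord_max.
Proof. by rewrite /dop_eval msuppX big_seq1 mcoeffX eqxx scale1r. Qed.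

Lemma dop_eval1 P Q : dop_eval P Q 1 = 1.
Proof. by rewrite -mpolyX0 dop_evalXm !mnmE !expr0 mulr1. Qed.

Lemma dop_evalM P Q g h : GRing.comm P Q ->
  dop_eval P Q (g * h) = dop_eval P Q g * dop_eval P Q h.
Proof.
move=> PQ; have evalXM m h' :
    dop_eval P Q ('X_[m] * h') = dop_eval P Q 'X_[m] * dop_eval P Q h'.
  rewrite [h']mpolyE mulr_sumr !linear_sum mulr_sumr; apply: eq_bigr => m' _.
  rewrite -scalerAr !linearZ /= -scalerAr; congr (_ *: _).
  rewrite -mpolyXD !dop_evalXm !mnmDE !exprD -!mulrA; congr (_ * _).
  rewrite !mulrA; congr (_ * _).
  exact/commrX/commr_sym/commrX/commr_sym.
rewrite [g]mpolyE mulr_suml !linear_sum mulr_suml; apply: eq_bigr => m _.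
by rewrite -scalerAl !linearZ /= evalXM scalerAl.
Qed.

(* [BC] and [gen_subalg] take the proof that P and Q commute as an argument   *)
(* so that the ideal and subalgebra instances can be keyed on them.           *)
Definition BC P Q of GRing.comm P Q : {pred {mpoly C[2]}} :=
  [pred g | dop_eval P Q g == 0].

Definition gen_subalg P Q of GRing.comm P Q : {pred dop} :=
  [pred R | `[< exists g, R = dop_eval P Q g >]].

Section Fixed.
Variables (P Q : dop) (PQ : GRing.comm P Q).

Lemma BC_idealr_closed : idealr_closed (BC PQ).
Proof.
split; rewrite ?inE ?raddf0 ?dop_eval1 ?oner_eq0 //.
move=> a g h; rewrite !inE => /eqP g0 /eqP h0.
by rewrite raddfD /= dop_evalM // g0 h0 mulr0 addr0.
Qed.
HB.instance Definition _ := isIdealr.Build {mpoly C[2]} (BC PQ) BC_idealr_closed.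

Definition BC_quot := {ideal_quot BC PQ}.
HB.instance Definition _ := GRing.ComNzRing.on BC_quot.
HB.instance Definition _ := NzRingQuotient.on BC_quot.

Definition BC_scale (c : C) (x : BC_quot) : BC_quot := \pi_BC_quot c%:MP * x.

Lemma BC_scaleA c d x : BC_scale c (BC_scale d x) = BC_scale (c * d) x.
Proof. by rewrite /BC_scale mulrA -rmorphM -mpolyCM. Qed.
Lemma BC_scale1 : left_id 1 BC_scale.
Proof. by move=> x; rewrite /BC_scale mpolyC1 rmorph1 mul1r. Qed.
Lemma BC_scaleDr : right_distributive BC_scale +%R.
Proof. by move=> c x y; rewrite /BC_scale mulrDr. Qed.
Lemma BC_scaleDl x : {morph BC_scale^~ x : c d / c + d}.
Proof. by move=> c d; rewrite /BC_scale mpolyCD raddfD mulrDl. Qed.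
HB.instance Definition _ := GRing.Zmodule_isLmodule.Build C BC_quot
  BC_scaleA BC_scale1 BC_scaleDr BC_scaleDl.

Lemma BC_scaleAl c (x y : BC_quot) : c *: (x * y) = c *: x * y.
Proof. exact: mulrA. Qed.
HB.instance Definition _ := GRing.Lmodule_isLalgebra.Build C BC_quot BC_scaleAl.

HB.instance Definition _ := GRing.Lalgebra_isComAlgebra.Build C BC_quot.

Lemma pi_BC_quotZ c g : \pi_BC_quot (c *: g) = c *: \pi_BC_quot g.
Proof. by rewrite -mul_mpolyC rmorphM. Qed.

Lemma gen_subalg_closed : subalg_closed (gen_subalg PQ).
Proof.
split=> [|c R S|R S]; rewrite !inE.
- by apply/asboolP; exists 1; rewrite dop_eval1.
- move=> /asboolP[g ->] /asboolP[h ->]; apply/asboolP; exists (c *: g + h).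
  by rewrite linearP.
- move=> /asboolP[g ->] /asboolP[h ->]; apply/asboolP; exists (g * h).
  by rewrite dop_evalM.
Qed.
HB.instance Definition _ :=
  GRing.isSubalgClosed.Build C dop (gen_subalg PQ) gen_subalg_closed.

Definition gen_alg := {R : dop | R \in gen_subalg PQ}.
HB.instance Definition _ := SubChoice.on gen_alg.
HB.instance Definition _ := [SubChoice_isSubAlgebra of gen_alg by <:].

Lemma gen_alg_mulC : commutative (@GRing.mul gen_alg).
Proof.
move=> [R Rin] [S Sin]; apply: val_inj; rewrite !rmorphM /=.
move: Rin Sin; rewrite !inE => /asboolP[g ->] /asboolP[h ->].
by rewrite -!dop_evalM // mulrC.
Qed.
HB.instance Definition _ :=
  GRing.PzRing_hasCommutativeMul.Build gen_alg gen_alg_mulC.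

End Fixed.
End CommutingPair.

Section AffineVarieties.
Variables (n : nat) (F : fieldType).

Definition zero_locus (J : {pred {mpoly F[n]}}) (v : 'I_n -> F) : Prop :=
  forall g, g \in J -> g.@[v] = 0.

(* The coordinate ring of V is the quotient of {mpoly F[n]} by this ideal.     *)
Definition vanishing_ideal (V : ('I_n -> F) -> Prop) (g : {mpoly F[n]}) : Prop :=
  forall v, V v -> g.@[v] = 0.

End AffineVarieties.

Definition spectral_curve (K : diffFieldType) (P Q : diffop K)
    (PQ : GRing.comm P Q) : ('I_2 -> constants K) -> Prop :=
  zero_locus (BC PQ).

(* Main.v *)
Require Import Defs.
From HB Require Import structures.
From mathcomp Require Import all_boot all_order all_algebra.
From mathcomp Require Import boolp mpoly.
Set Implicit Arguments.
Unset Strict Implicit.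
Unset Printing Implicit Defensive.
Local Open Scope ring_scope.
Import GRing.Theory.
Local Open Scope quotient_scope.

(** Evaluation at (P, Q) identifies the quotient of the polynomial ring by
    BC(P, Q) with its image, so what has to be proved is that the image has no
    zero divisors and that BC(P, Q) is exactly the ideal of the polynomials
    vanishing on the spectral curve.

    Orders add up in the ring of differential operators ([size_dmul]): the
    leading coefficient of a product is the product of the leading
    coefficients, because commuting a coefficient past the derivation only
    creates terms of lower order.  Hence that ring has no zero divisors, the
    subring generated by P and Q is a domain, and BC(P, Q) is prime.

    A prime ideal J of polynomials in two variables over an algebraically
    closed field is the ideal of its zero locus; the instance needed here has
    an elementary proof ([plane_nullstellensatz]).  Since P has positive order,
    a nonzero polynomial in P alone is never zero ([dop_eval_transcendental]),
    so J meets the polynomials in the first variable x only in 0.  Regard J as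
    an ideal of F[x][y].  If J = 0, any point where g is nonzero separates g
    from J.  Otherwise let h be a nonzero element of J of minimal degree in y,
    with leading coefficient l in F[x].  Pseudo-division by h shows that some
    power of l multiplies each element of J into a multiple of h, so every
    zero of h with l(x) != 0 is a zero of J.  For g outside J, a Euclidean
    descent ([eliminate]) produces u with u g congruent modulo J to a nonzero
    r in F[x].  Choose x with l(x) r(x) != 0, and then a root y of h(x, _): all
    of J vanishes at (x, y), but u g takes the value r(x) there, so g does not
    vanish. *)

(** * Orders of products of differential operators *)

Section Order.
Variable K : diffFieldType.
Implicit Types (p q : {poly K}) (P Q : diffop K).

Lemma size_dshift q : q != 0 -> size (dshift q) = (size q).+1.
Proof.
move=> q0; rewrite /dshift size_polyDl size_mulX // ltnS.
exact: size_poly.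
Qed.

Lemma size_iter_dshift i q :
  q != 0 -> size (iter i (@dshift K) q) = (i + size q)%N.
Proof.
move=> q0; elim: i => //= i IHi; rewrite size_dshift ?IHi //.
by rewrite -size_poly_gt0 IHi addn_gt0 size_poly_gt0 q0 orbT.
Qed.

(** The i-th summand of the product has size at most i + size q; only the last
    index reaches the announced size, and there the leading coefficient
    survives. *)
Lemma size_dmul p q : p != 0 -> q != 0 ->
  size (dmul p q) = (size p + size q).-1.
Proof.
move=> p0 q0; have p_gt0 : (0 < size p)%N by rewrite size_poly_gt0.
rewrite /dmul; set n := size p; have def_n : n = n.-1.+1 by rewrite prednK.
rewrite def_n big_ord_recr /= addrC size_polyDl.
  by rewrite size_scale ?size_iter_dshift // -/(lead_coef p) lead_coef_eq0.
rewrite size_scale -/(lead_coef p) ?lead_coef_eq0 // size_iter_dshift //.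
have [n0|n_gt0] := posnP n.-1; first by rewrite n0 big_ord0 size_poly0 size_poly_gt0.
apply: (@leq_ltn_trans (n.-1 + size q).-1); last first.
  by rewrite prednK // addn_gt0 n_gt0.
apply: leq_trans (size_sum _ _ _) _; apply/bigmax_leqP => i _.
apply: leq_trans (size_scale_leq _ _) _; rewrite size_iter_dshift //.
by rewrite -ltnS prednK ?addn_gt0 ?n_gt0 // ltn_add2r.
Qed.

Lemma dop_mulf_eq0 P Q : (P * Q == 0) = (P == 0) || (Q == 0).
Proof.
have coefs0 (R : diffop K) : (R == 0) = (coefs R == 0).
  by apply/eqP/eqP => [-> | R0] //; apply: coefs_inj.
apply/idP/idP => [|/orP[]/eqP->]; rewrite ?mul0r ?mulr0 //.
apply: contraTT; rewrite negb_or !coefs0 => /andP[P0 Q0].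
rewrite -size_poly_gt0 /= size_dmul // -subn1 subn_gt0.
by apply: (@leq_add 1 1); rewrite size_poly_gt0.
Qed.

End Order.

(** * Polynomials in two variables as iterated polynomials *)

Section Bivariate.
Variable F : comNzRingType.

(** The inner variable is sent to the one with index 0, and the outer variable
    to the one with index 1, so that evaluating P at the former is a question
    about constants of the outer polynomial ring. *)
Definition mpoly_of_bivariate : {poly {poly F}} -> {mpoly F[2]} :=
  horner_eval 'X_ord_max \o map_poly (horner_alg 'X_ord0).
HB.instance Definition _ := GRing.RMorphism.on mpoly_of_bivariate.

Lemma mpoly_of_bivariateC p : mpoly_of_bivariate p%:P = horner_alg 'X_ord0 p.
Proof. by rewrite /mpoly_of_bivariate /= map_polyC /= /horner_eval hornerC. Qed.

Lemma mpoly_of_bivariateX : mpoly_of_bivariate 'X = 'X_ord_max.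
Proof. by rewrite /mpoly_of_bivariate /= map_polyX /horner_eval hornerX. Qed.

Lemma mpoly_of_bivariate_surj g : exists h, mpoly_of_bivariate h = g.
Proof.
elim/mpolyind: g => [|c m g _ _ [h <-]]; first by exists 0; rewrite rmorph0.
exists ((c *: 'X^(m ord0))%:P * 'X^(m ord_max) + h).
rewrite rmorphD rmorphM rmorphXn /= mpoly_of_bivariateC mpoly_of_bivariateX.
rewrite linearZ /= rmorphXn /= horner_algX -!scalerAl mul1r; congr (_ *: _ + _).
rewrite [RHS]mpolyXE_id big_ord_recl big_ord1.
by rewrite (_ : lift _ _ = ord_max) //; apply: val_inj.
Qed.

Lemma meval_bivariate (v : 'I_2 -> F) h :
  (mpoly_of_bivariate h).@[v] = h.[(v ord_max)%:P].[v ord0].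
Proof.
rewrite /mpoly_of_bivariate /= /horner_eval -horner_map /= mevalXU.
rewrite -map_poly_comp -[RHS]horner_evalE -horner_map /= horner_evalE hornerC.
congr (_.[_]); apply: eq_map_poly => p /=.
rewrite horner_evalE /horner_alg /horner_morph -horner_map /= mevalXU.
rewrite -map_poly_comp; congr (_.[_]); apply: map_poly_id => c _ /=.
by rewrite mevalZ meval1 mulr1.
Qed.

End Bivariate.

(** * Points over an algebraically closed field *)

Section ClosedField.
Variables (F : fieldType) (closedF : GRing.closed_field_axiom F).

Lemma closed_exists_root (p : {poly F}) : (1 < size p)%N -> exists x, p.[x] = 0.
Proof.
move=> p_gt1; have p0 : p != 0 by rewrite -size_poly_gt0 ltnW.
have lc0 : lead_coef p != 0 by rewrite lead_coef_eq0.
(* The closure axiom solves monic equations x ^+ n = \sum_i a_i x ^+ i. *)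
have [|x Dx] := closedF (fun i => - p`_i / lead_coef p) (n := (size p).-1).
  by rewrite -subn1 subn_gt0.
exists x; rewrite horner_coef; have def_n : size p = (size p).-1.+1.
  by rewrite prednK // size_poly_gt0.
rewrite def_n big_ord_recr /= Dx -/(lead_coef p) mulr_sumr -big_split /=.
rewrite big1 // => i _; rewrite mulrA mulrCA divff // mulr1 mulNr.
by rewrite subrr.
Qed.

(** A root of p - 1 is not a root of p; this spares the infinity of F. *)
Lemma closed_exists_nonroot (p : {poly F}) : p != 0 -> exists x, p.[x] != 0.
Proof.
move=> p0; have [p_gt1|p_le1] := ltnP 1 (size p).
  have [|x px1] := @closed_exists_root (p - 1).
    by rewrite size_polyDl ?size_polyN ?size_poly1.
  exists x; rewrite -[p](subrK 1) hornerD px1 add0r hornerC; exact: oner_neq0.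
by exists 0; rewrite (size1_polyC p_le1) hornerC -polyC_eq0 -size1_polyC.
Qed.

End ClosedField.

(** * Elimination modulo a prime ideal of R[y] *)

Section Elimination.
Variables (R : idomainType) (J : prime_idealr {poly R}).
Hypothesis J_const : forall c : R, c%:P \in J -> c = 0.
Variable h : {poly R}.
Hypotheses (h0 : h != 0) (hJ : h \in J).
Hypothesis h_min : forall h', h' \in J -> h' != 0 -> (size h <= size h')%N.
Implicit Types g : {poly R}.

Lemma min_gt1 : (1 < size h)%N.
Proof.
rewrite ltnNge; apply: contraNN h0 => h_le1.
by move: hJ; rewrite (size1_polyC h_le1) => /J_const->.
Qed.

Lemma prime_idealZ c g : c != 0 -> (c *: g \in J) = (g \in J).
Proof.
move=> c0; rewrite -mul_polyC prime_idealrM orb_idl // => /J_const c_eq0.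
by rewrite c_eq0 eqxx in c0.
Qed.

Lemma lead_coefX_neq0 g k : g != 0 -> lead_coef g ^+ k != 0.
Proof. by move=> g0; rewrite expf_neq0 // lead_coef_eq0. Qed.

(** Pseudo-division multiplies g by a power of the leading coefficient of h,
    which keeps it in J; the remainder is then in J, and too short to be
    nonzero. *)
Lemma modp_min g : g \in J -> g %% h = 0.
Proof.
move=> gJ; apply/eqP; apply: contraTT (ltn_modpN0 g h0) => r0.
rewrite -leqNgt h_min // -(addKr (g %/ h * h) (g %% h)) -Pdiv.Idomain.divp_eq.
by rewrite addrC rpredB ?idealMr ?prime_idealZ ?lead_coefX_neq0.
Qed.

(** The Euclidean algorithm, run modulo J on g and h: by primality of J and
    minimality of h, the successive remainders stay outside J, so they go on
    getting shorter until a nonzero constant is reached. *)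
Lemma eliminate g : g \notin J ->
  exists u, exists2 r : R, r != 0 & u * g - r%:P \in J.
Proof.
have [n] := ubnP (size g); elim: n g => // n IHn g; rewrite ltnS => g_le_n gJ.
have g0 : g != 0 by apply: contraNneq gJ => ->; apply: rpred0.
have [g_le1|g_gt1] := leqP (size g) 1.
  exists 1, g`_0; last by rewrite mul1r -size1_polyC // subrr rpred0.
  by rewrite -polyC_eq0 -size1_polyC.
have [h_le_g|g_lt_h] := leqP (size h) (size g).
  have eq_g := Pdiv.Idomain.divp_eq g h.
  have [||u [r r0 ur]] := IHn (g %% h).
  - by apply: leq_trans g_le_n; apply: leq_trans h_le_g; rewrite ltn_modp.
  - apply: contra gJ => rJ; rewrite -(@prime_idealZ (lead_coef h ^+ scalp g h)).
      by rewrite eq_g rpredD ?idealMr.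
    exact: lead_coefX_neq0.
  - exists (u * (lead_coef h ^+ scalp g h)%:P), r => //.
    rewrite -mulrA mul_polyC eq_g mulrDr -addrA rpredD //.
    by rewrite !idealMr.
(* Here g is shorter than h, so h is divided by g.  The quotient is nonzero and
   shorter than h, hence outside J; were the remainder in J, so would be the
   product of the quotient and g. *)
have eq_h := Pdiv.Idomain.divp_eq h g.
have q0 : h %/ g != 0 by rewrite divpN0 // ltnW.
have qJ : h %/ g \notin J.
  apply/negP => /h_min/(_ q0); apply/negP; rewrite -ltnNge size_divp //.
  by rewrite ltn_subrL -subn1 subn_gt0 g_gt1 ltnW ?min_gt1.
have rJ : h %% g \notin J.
  apply/negP => rJ; have : h %/ g * g \in J.
    by rewrite -(addrK (h %% g) (_ * g)) -eq_h rpredB ?prime_idealZ ?lead_coefX_neq0.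
  by rewrite prime_idealrM (negPf qJ) (negPf gJ).
have [|u [r r0 ur]] := IHn _ _ rJ.
  by apply: leq_trans g_le_n; rewrite ltn_modp.
exists (- (u * (h %/ g))), r => //.
have -> : - (u * (h %/ g)) * g - r%:P =
    u * (h %% g) - r%:P - u * (lead_coef g ^+ scalp h g *: h).
  by rewrite eq_h mulrDr mulNr mulrA opprD [RHS]addrC -addrA addKr.
by rewrite rpredB ?idealMr ?prime_idealZ ?lead_coefX_neq0.
Qed.

End Elimination.

(** * The Nullstellensatz for prime ideals of the plane *)

(** The hypothesis on constants says that the projection of the zero locus to
    the x-axis is dense; it is what allows x to be chosen outside finitely many
    bad values before y is solved for. *)
Lemma plane_nullstellensatz (F : fieldType)
    (closedF : GRing.closed_field_axiom F) (J : prime_idealr {poly {poly F}})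
    (J_const : forall p : {poly F}, p%:P \in J -> p = 0) g :
  g \notin J ->
  exists x y, (forall h, h \in J -> h.[y%:P].[x] = 0) /\ g.[y%:P].[x] != 0.
Proof.
move=> gJ.
have eval2 (h : {poly {poly F}}) x y :
    h.[y%:P].[x] = (map_poly (horner_eval x) h).[y].
  by rewrite -[LHS]horner_evalE -horner_map /= horner_evalE hornerC.
have [[h hJ h0]|J0] := pselect (exists2 h, h \in J & h != 0); last first.
  (* J = 0: avoid the zeros of the leading coefficient of g, then those of g. *)
  have lg0 : lead_coef g != 0.
    by rewrite lead_coef_eq0; apply: contraNneq gJ => ->; apply: rpred0.
  have [x gx] := closed_exists_nonroot closedF lg0.
  have gx0 : map_poly (horner_eval x) g != 0.
    apply: contraNneq gx => /(congr1 (fun p : {poly F} => p`_(size g).-1)).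
    by rewrite coef_map coef0 /= horner_evalE => ->.
  have [y gxy] := closed_exists_nonroot closedF gx0.
  exists x, y; split=> [h hJ|]; last by rewrite eval2.
  have [->|h0] := eqVneq h 0; first by rewrite !horner0.
  by case: J0; exists h.
have exh : exists n, `[< exists h, [/\ h \in J, h != 0 & size h = n] >].
  by exists (size h); apply/asboolP; exists h.
have [n /asboolP[{hJ h0}h [hJ h0 <-]] n_min] := ex_minnP exh.
have h_min h' : h' \in J -> h' != 0 -> (size h <= size h')%N.
  by move=> h'J h'0; apply: n_min; apply/asboolP; exists h'.
have [u [r r0 ugr]] := eliminate J_const h0 hJ h_min gJ.
have lc0 : lead_coef h != 0 by rewrite lead_coef_eq0.
(* Where the leading coefficient of h does not vanish, h keeps its degree in y,
   hence has a root, and pseudo-division by h can be undone. *)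
have [x] := closed_exists_nonroot closedF (mulf_neq0 lc0 r0).
rewrite hornerM mulf_eq0 negb_or => /andP[lcx rx].
have [|y hxy] := @closed_exists_root F closedF (map_poly (horner_eval x) h).
  rewrite size_poly_eq ?(min_gt1 J_const h0) //.
exists x, y.
have vanish h' : h' \in J -> h'.[y%:P].[x] = 0.
  move=> h'J; have := congr1 (fun p => p.[y%:P].[x]) (Pdiv.Idomain.divp_eq h' h).
  rewrite (modp_min J_const h0 hJ h_min) // addr0 hornerZ !hornerM !eval2 hxy.
  rewrite mulr0 => /eqP; rewrite mulf_eq0 => /orP[|/eqP//].
  by rewrite horner_exp expf_eq0 (negPf lcx) andbF.
split=> //; apply: contraNneq rx => gxy.
by have := vanish _ ugr; rewrite !hornerE gxy mulr0 add0r => /eqP; rewrite oppr_eq0.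
Qed.

(** * The ideal BC(P, Q) is prime and contains no polynomial in P alone *)

Section PreimageIdeal.
Variables (R S : comNzRingType) (f : {rmorphism R -> S}) (J : prime_idealr S).

Definition preim_ideal : {pred R} := [pred x | f x \in J].

Lemma preim_idealE x : (x \in preim_ideal) = (f x \in J).
Proof. by []. Qed.

Lemma preim_idealr_closed : idealr_closed preim_ideal.
Proof.
split; rewrite ?preim_idealE ?rmorph0 ?rmorph1 ?rpred0 ?idealr1 //.
move=> a x y; rewrite !preim_idealE rmorphD rmorphM => xJ yJ.
by rewrite rpredD ?idealMr.
Qed.
HB.instance Definition _ := isIdealr.Build R preim_ideal preim_idealr_closed.

Lemma preim_ideal_prime : prime_idealr_closed preim_ideal.
Proof. by move=> x y; rewrite !preim_idealE rmorphM prime_idealrM. Qed.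
HB.instance Definition _ :=
  isPrimeIdealrClosed.Build R preim_ideal preim_ideal_prime.

End PreimageIdeal.

Section SpectralIdeal.
Variables (K : diffFieldType) (P Q : diffop K) (PQ : GRing.comm P Q).
Notation C := (constants K).

Lemma BC_prime : prime_idealr_closed (BC PQ).
Proof. by move=> g h; rewrite !inE dop_evalM // dop_mulf_eq0. Qed.
HB.instance Definition _ :=
  isPrimeIdealrClosed.Build {mpoly C[2]} (BC PQ) BC_prime.

(** Horner's scheme: with R the value of a shorter nonzero polynomial, the
    order of R P is at least that of P, hence positive, so adding a scalar
    cannot cancel it. *)
Lemma dop_eval_transcendental (p : {poly C}) : (0 < dop_order P)%N -> p != 0 ->
  dop_eval P Q (horner_alg 'X_ord0 p) != 0.
Proof.
move=> P_gt0; elim/poly_ind: p => [|p c IHp]; first by rewrite eqxx.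
have -> : dop_eval P Q (horner_alg 'X_ord0 (p * 'X + c%:P)) =
    dop_eval P Q (horner_alg 'X_ord0 p) * P + c *: 1.
  have -> : horner_alg 'X_ord0 (p * 'X + c%:P) =
      horner_alg 'X_ord0 p * 'X_ord0 + c *: (1 : {mpoly C[2]}).
    by rewrite rmorphD rmorphM /= horner_algX horner_algC.
  rewrite linearD linearZ /= dop_evalM //.
  by rewrite dop_eval1 dop_evalXm !mnm1E eqxx expr1 expr0 mulr1.
have [->|p0] := eqVneq p 0.
  rewrite mul0r add0r polyC_eq0 rmorph0 linear0 mul0r add0r => c0.
  by rewrite scaler_eq0 negb_or c0 oner_neq0.
move/IHp: p0; move: (dop_eval _ _ _) => R R0 _.
have P0 : P != 0.
  by apply: contraTneq P_gt0 => ->; rewrite /dop_order size_poly0.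
have coefs0 (T : diffop K) : (coefs T == 0) = (T == 0).
  by apply/eqP/eqP => [T0|->] //; apply: coefs_inj.
rewrite addr_eq0; apply/eqP => /(congr1 (fun T => size (coefs T))).
rewrite /= size_dmul ?coefs0 // size_polyN => E.
have := size_scale_leq (val c) (1 : {poly K}).
rewrite -E size_poly1; apply/negP; rewrite -ltnNge -subn1 ltn_subRL.
apply: (@leq_add 1 2); first by rewrite size_poly_gt0 coefs0.
by rewrite -subn_gt0 subn1.
Qed.
End SpectralIdeal.


(** * The coordinate ring of the spectral curve *)

Section CoordinateRing.
Variables (K : diffFieldType) (P Q : diffop K) (PQ : GRing.comm P Q).
Notation C := (constants K).

Lemma BC_separated (C_closed : GRing.closed_field_axiom C) g :
  (0 < dop_order P)%N -> g \notin BC PQ ->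
  exists2 v, spectral_curve PQ v & g.@[v] != 0.
Proof.
move=> P_gt0; have [h <-] := mpoly_of_bivariate_surj g.
rewrite -(preim_idealE (@mpoly_of_bivariate C) (BC PQ)) => hJ.
have [|x [y [vanish hxy]]] := plane_nullstellensatz C_closed _ hJ.
  move=> p; rewrite preim_idealE /= mpoly_of_bivariateC inE => p0.
  by apply: contraTeq p0 => /(dop_eval_transcendental PQ P_gt0).
exists (fun i => if i == ord0 then x else y); last by rewrite meval_bivariate.
move=> g'; have [h' <-] := mpoly_of_bivariate_surj g'.
rewrite -(preim_idealE (@mpoly_of_bivariate C) (BC PQ)) meval_bivariate.
exact: vanish.
Qed.

Lemma dop_eval_gen g : dop_eval P Q g \in gen_subalg PQ.
Proof. by rewrite inE; apply/asboolP; exists g. Qed.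

Definition BC_eval (x : BC_quot PQ) : gen_alg PQ :=
  exist _ (dop_eval P Q (repr x)) (dop_eval_gen (repr x)).

(** Two representatives of a class differ by an element of BC(P, Q), which
    evaluates to 0: so [BC_eval] does not depend on the choice made by
    [repr]. *)
Lemma val_BC_eval_pi g : val (BC_eval (\pi_(BC_quot PQ) g)) = dop_eval P Q g.
Proof.
apply/eqP; rewrite /= -subr_eq0 -linearB.
have := Quotient.idealrBE (BC PQ) (repr (\pi_(BC_quot PQ) g)) g.
by rewrite reprK eqxx inE.
Qed.

Lemma BC_evalB : {morph BC_eval : x y / x - y}.
Proof.
elim/quotW=> g; elim/quotW=> h; apply: val_inj.
rewrite -rmorphB [RHS]raddfB; apply: etrans (val_BC_eval_pi _) _.
by rewrite linearB; congr (_ - _); apply: (esym (val_BC_eval_pi _)).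
Qed.
HB.instance Definition _ :=
  GRing.isZmodMorphism.Build (BC_quot PQ) (gen_alg PQ) BC_eval BC_evalB.

Lemma BC_evalZ : scalable BC_eval.
Proof.
move=> c; elim/quotW=> g; apply: val_inj.
rewrite -pi_BC_quotZ [RHS]linearZ; apply: etrans (val_BC_eval_pi _) _.
by rewrite linearZ; congr (_ *: _); apply: (esym (val_BC_eval_pi _)).
Qed.
HB.instance Definition _ :=
  GRing.isScalable.Build C (BC_quot PQ) (gen_alg PQ) *:%R BC_eval BC_evalZ.

Lemma BC_evalM : monoid_morphism BC_eval.
Proof.
split=> [|x y].
  by apply: val_inj; rewrite -(rmorph1 \pi_(BC_quot PQ)) val_BC_eval_pi dop_eval1.
elim/quotW: x => g; elim/quotW: y => h; apply: val_inj.
rewrite -rmorphM [RHS]rmorphM; apply: etrans (val_BC_eval_pi _) _.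
by rewrite dop_evalM //; congr (_ * _); apply: (esym (val_BC_eval_pi _)).
Qed.
HB.instance Definition _ :=
  GRing.isMonoidMorphism.Build (BC_quot PQ) (gen_alg PQ) BC_eval BC_evalM.

Lemma BC_eval_bij : bijective BC_eval.
Proof.
have surj R : exists x, BC_eval x = R.
  have /asboolP[g Dg] := valP R; exists (\pi_(BC_quot PQ) g).
  by apply: val_inj; rewrite val_BC_eval_pi.
have inj : injective BC_eval.
  elim/quotW=> g; elim/quotW=> h /(congr1 val)/eqP.
  rewrite !val_BC_eval_pi -subr_eq0 -linearB => gh; apply/eqP.
  by rewrite -Quotient.idealrBE inE.
exists (fun R => sval (cid (surj R))) => [x|R].
  by apply: inj; apply: (svalP (cid (surj _))).
exact: (svalP (cid (surj R))).
Qed.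

Lemma gen_alg_domain : GRing.integral_domain_axiom (gen_alg PQ).
Proof.
move=> R T /(congr1 val); rewrite rmorphM rmorph0 => /eqP.
rewrite dop_mulf_eq0 => /orP[]/eqP R0; apply/orP; [left | right];
  by apply/eqP; apply: val_inj; rewrite R0 rmorph0.
Qed.

End CoordinateRing.

Theorem theorem3p5 (S : diffFieldType)
    (C_closed : GRing.closed_field_axiom (constants S))
    (C_char0 : [pchar constants S] =i pred0)
    (P Q : diffop S)
    (P_nconst : P \notin @const_coefs S) (Q_nconst : Q \notin @const_coefs S)
    (P_order : (0 < dop_order P)%N) (Q_order : (0 < dop_order Q)%N)
    (PQ : GRing.comm P Q) :
  [/\ GRing.integral_domain_axiom (gen_alg PQ),
      exists f : {lrmorphism BC_quot PQ -> gen_alg PQ}, bijective f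
    & forall g : {mpoly (constants S)[2]},
        g \in BC PQ <-> vanishing_ideal (spectral_curve PQ) g].
Proof.
split.
- exact: gen_alg_domain.
- by exists (BC_eval (PQ := PQ)); apply: BC_eval_bij.
move=> g; split=> [gBC v onV | gV]; first exact: onV.
apply/negPn/negP => /(BC_separated C_closed P_order)[v /gV->].
by rewrite eqxx.
Qed.
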